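(* Let $X$ be a Banach space and let $0\le\nu\le1$. Then $$\mu'(X,B)\,[H_\nu(X,B)]^2\ge2.$$
   Context: $S_X$ is the unit sphere of $X$. For $x,y\in X$, $x\perp_B y$ (Birkhoff orthogonality) means $\|x+\lambda y\|\ge\|x\|$ for all real $\lambda$. For $0\le\nu\le1$, $$H_\nu(X,B)=\sup\left\{\frac{\|x+y\|^{\nu}\|x-y\|^{1-\nu}+\|x+y\|^{1-\nu}\|x-y\|^{\nu}}{2}:\ x,y\in S_X,\ x\perp_B y\right\}.$$ The rectangular constant is $$\mu'(X,B)=\sup\left\{\frac{2}{\|x+y\|}:\ x,y\in S_X,\ x\perp_B y\right\}.$$ *)

(* Defs.v *)
From HB Require Import structures.
From mathcomp Require Import all_boot all_order all_algebra.
From mathcomp Require Import all_classical all_reals all_analysis.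
Import Order.TTheory GRing.Theory Num.Theory.
Import numFieldNormedType.Exports.

Set Implicit Arguments.
Unset Strict Implicit.
Unset Printing Implicit Defensive.

Local Open Scope classical_set_scope.
Local Open Scope ring_scope.

Definition birkhoff_orth (R : realType) (X : normedModType R) (x y : X) : Prop :=
  forall l : R, `|x| <= `|x + l *: y|.

Definition unit_sphere (R : realType) (X : normedModType R) : set X :=
  [set x | `|x| = 1].

Definition birkhoff_pairs (R : realType) (X : normedModType R) : set (X * X) :=
  [set p | unit_sphere p.1 /\ unit_sphere p.2 /\ birkhoff_orth p.1 p.2].

(* The real-valued [sup] below carries no junk value once dim X >= 2: both sets
   are then nonempty, and they are bounded because 1 <= `|x +- y| <= 2 for
   Birkhoff orthogonal unit vectors x, y. *)
Definition H_const (R : realType) (X : normedModType R) (nu : R) : R :=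
  sup [set (`|p.1 + p.2| `^ nu * `|p.1 - p.2| `^ (1 - nu)
            + `|p.1 + p.2| `^ (1 - nu) * `|p.1 - p.2| `^ nu) / 2
      | p in @birkhoff_pairs R X].

Definition rect_const (R : realType) (X : normedModType R) : R :=
  sup [set 2 / `|p.1 + p.2| | p in @birkhoff_pairs R X].

(* dim X >= 2 (X may be infinite-dimensional).  If dim X <= 1 there are no
   Birkhoff orthogonal unit vectors, and the suprema above range over the
   empty set. *)
Definition dim_ge2 (R : realType) (X : normedModType R) : Prop :=
  exists u v : X, forall a b : R, a *: u + b *: v = 0 -> a = 0 /\ b = 0.

(* Main.v *)
(* For Birkhoff orthogonal unit vectors x, y put a = |x + y| and b = |x - y|.
   The two products in the definition of H_nu multiply to a * b, so AM-GM gives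
   H_nu ^ 2 >= a * b; with mu' >= 2 / a this yields mu' * H_nu ^ 2 >= 2 * b, and
   b >= |x| = 1 by orthogonality. Such a pair exists in dimension at least 2:
   for independent u, v, a minimizer t of |v + t u| makes v + t u orthogonal
   to u. *)
Require Import Defs.
From HB Require Import structures.
From mathcomp Require Import all_boot all_order all_algebra.
From mathcomp Require Import all_classical all_reals all_analysis.
From mathcomp Require Import lra.
Import Order.TTheory GRing.Theory Num.Theory.
Import numFieldNormedType.Exports.

Set Implicit Arguments.
Unset Strict Implicit.
Unset Printing Implicit Defensive.

Local Open Scope classical_set_scope.
Local Open Scope ring_scope.

Section BirkhoffPairs.
Variables (R : realType) (X : normedModType R).
Implicit Types (x y u v : X) (a b t nu : R).

(** For nonzero [a], pulling [a] out of the norm leaves the orthogonality of [x] and [y] at the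
    scalar [a^-1 * l * b]. This allows an orthogonal pair to be normalized. *)
Lemma birkhoff_orthZ x y a b :
  birkhoff_orth x y -> birkhoff_orth (a *: x) (b *: y).
Proof.
move=> xy l; have [->|a0] := eqVneq a 0; first by rewrite scale0r normr0.
have -> : a *: x + l *: (b *: y) = a *: (x + (a^-1 * l * b) *: y).
  by rewrite scalerDr !scalerA !mulrA divff// mul1r.
by rewrite !normrZ ler_wpM2l.
Qed.

Lemma norm_line_min u v : u != 0 ->
  exists t0, forall t, `|v + t0 *: u| <= `|v + t *: u|.
Proof.
move=> u0; have nu0 : 0 < `|u| by rewrite normr_gt0.
(* Beyond [M] the triangle inequality gives [f t >= |t| |u| - |v| > |v| = f 0], so a minimum over
   the compact interval [[-M, M]] is global. *)
pose f t := `|v + t *: u|; pose M := 2 * `|v| / `|u|.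
have M0 : 0 <= M by rewrite divr_ge0// mulr_ge0.
have fc : continuous f.
  move=> t; apply: cvg_norm; apply: cvgD; first exact: cvg_cst.
  by apply: cvgZr_tmp; exact: cvg_id.
have [|c _ cmin] := @EVT_min R f (- M) M _ (continuous_subspaceT fc).
  by rewrite (le_trans _ M0)// oppr_le0.
exists c => t; have [tM|Mt] := leP `|t| M.
  by apply: cmin; rewrite in_itv/= -ler_norml.
have fc0 : f c <= `|v|.
  rewrite (le_trans (cmin 0 _))//; first by rewrite in_itv/= oppr_le0 M0.
  by rewrite /f scale0r addr0.
apply: (le_trans fc0).
have : 2 * `|v| < `|t *: u| by rewrite normrZ -ltr_pdivrMr.
have : `|t *: u| <= `|v + t *: u| + `|v|.
  by rewrite -{1}(addKr v (t *: u)) addrC (le_trans (ler_normB _ _)).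
lra.
Qed.

Lemma birkhoff_pairs_nonempty : dim_ge2 X -> @birkhoff_pairs R X !=set0.
Proof.
move=> [u [v uv]].
have u0 : u != 0.
  apply/eqP => u0; have [/eqP] : 1 = 0 :> R /\ 0 = 0 :> R.
    by apply: uv; rewrite u0 scaler0 scale0r addr0.
  by rewrite oner_eq0.
have [t tmin] := norm_line_min v u0.
have w0 : v + t *: u != 0.
  apply/eqP => w0; have [_ /eqP] : t = 0 /\ 1 = 0 :> R.
    by apply: uv; rewrite scale1r addrC.
  by rewrite oner_eq0.
exists (`|v + t *: u|^-1 *: (v + t *: u), `|u|^-1 *: u).
split; last split.
- by rewrite /unit_sphere/= normrZ normfV normr_id mulVf// normr_eq0.
- by rewrite /unit_sphere/= normrZ normfV normr_id mulVf// normr_eq0.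
- apply: birkhoff_orthZ => l; rewrite -addrA -scalerDl; exact: tmin.
Qed.

(** The lower bounds are orthogonality at [l = 1] and [l = -1]; the upper ones are the triangle
    inequality. *)
Lemma birkhoff_pairs_norm_bounds (p : X * X) : birkhoff_pairs p ->
  1 <= `|p.1 + p.2| <= 2 /\ 1 <= `|p.1 - p.2| <= 2.
Proof.
move=> [x1 [y1 xy]]; rewrite /unit_sphere/= in x1 y1.
have := xy 1; have := xy (- 1); rewrite scaleN1r scale1r x1 => -> ->.
have := ler_normB p.1 p.2; have := ler_normD p.1 p.2.
by rewrite x1 y1.
Qed.

Lemma rect_const_ge (p : X * X) : birkhoff_pairs p ->
  2 / `|p.1 + p.2| <= rect_const X.
Proof.
move=> pX; apply: ub_le_sup; last by exists p.
exists 2 => _ [q /birkhoff_pairs_norm_bounds[/andP[q1 _] _] <-].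
by rewrite ler_pdivrMr ?(lt_le_trans ltr01)// ler_peMr.
Qed.

Lemma H_const_ge nu (p : X * X) : 0 <= nu <= 1 -> birkhoff_pairs p ->
  (`|p.1 + p.2| `^ nu * `|p.1 - p.2| `^ (1 - nu)
   + `|p.1 + p.2| `^ (1 - nu) * `|p.1 - p.2| `^ nu) / 2 <= H_const X nu.
Proof.
move=> /andP[nu0 nu1] pX; apply: ub_le_sup; last by exists p.
have powR_le2 a s : 1 <= a <= 2 -> 0 <= s <= 1 -> a `^ s <= 2.
  move=> /andP[a1 a2] /andP[s0 s1]; rewrite (le_trans _ a2)//.
  by rewrite -{2}(powRr1 (le_trans ler01 a1)) ler_powR.
have nu01 : 0 <= nu <= 1 by rewrite nu0.
have nu01' : 0 <= 1 - nu <= 1 by apply/andP; split; lra.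
(* Each power has base in [1, 2] and exponent in [0, 1], hence is at most 2; so each product, and
   their mean, is at most 4. *)
exists 4 => _ [q /birkhoff_pairs_norm_bounds[qD qB] <-].
have : `|q.1 + q.2| `^ nu * `|q.1 - q.2| `^ (1 - nu) <= 2 * 2.
  by rewrite ler_pM ?powR_ge0 ?powR_le2.
have : `|q.1 + q.2| `^ (1 - nu) * `|q.1 - q.2| `^ nu <= 2 * 2.
  by rewrite ler_pM ?powR_ge0 ?powR_le2.
lra.
Qed.

End BirkhoffPairs.

Lemma heinz_mean_sqr_ge (R : realType) (a b nu : R) : 0 < a -> 0 < b ->
  a * b <= ((a `^ nu * b `^ (1 - nu) + a `^ (1 - nu) * b `^ nu) / 2) ^+ 2.
Proof.
move=> a0 b0.
have powR_compl c : 0 < c -> c `^ nu * c `^ (1 - nu) = c.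
  by move=> c0; rewrite -powRD addrC subrK ?oner_eq0// powRr1 ?ltW.
rewrite -{1}(powR_compl a a0) -{1}(powR_compl b b0).
move: (a `^ _) (a `^ _) (b `^ _) (b `^ _) => p q r s.
(* [p * s] and [q * r] are the two products in the mean, and the gap between the two sides is
   [((p s - q r) / 2)^2]. *)
have := sqr_ge0 (p * s - q * r); nra.
Qed.

Theorem proposition3p8 (R : realType) (X : completeNormedModType R) (nu : R)
  (hX : dim_ge2 X) (hnu : 0 <= nu <= 1) :
  2 <= rect_const X * H_const X nu ^+ 2.
Proof.
have [p pX] := birkhoff_pairs_nonempty hX.
have [/andP[a1 _] /andP[b1 _]] := birkhoff_pairs_norm_bounds pX.
have a0 := lt_le_trans ltr01 a1; have b0 := lt_le_trans ltr01 b1.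
have mu_ge := rect_const_ge pX.
have H_ge := H_const_ge hnu pX.
have ab_le : `|p.1 + p.2| * `|p.1 - p.2| <= H_const X nu ^+ 2.
  apply: (le_trans (heinz_mean_sqr_ge nu a0 b0)).
  (* Squaring is monotone only on nonnegative reals; [H_const X nu] is nonnegative because it
     dominates the mean at [p]. *)
  rewrite lerXn2r// nnegrE ?(le_trans _ H_ge)//;
    by rewrite divr_ge0// addr_ge0// mulr_ge0// powR_ge0.
(* The middle term equals [2 * |p.1 - p.2|], which is at least 2 by [b1]. *)
apply: (@le_trans _ _ (2 / `|p.1 + p.2| * (`|p.1 + p.2| * `|p.1 - p.2|))).
  by rewrite mulrA divfK ?gt_eqF// ler_peMr.
by rewrite ler_pM// ?divr_ge0 ?mulr_ge0.
Qed.
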